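(* Let $X$ be a Hausdorff space, let $k\ge1$, and let $T$ be a set equipped with a decreasing sequence of subsets $T\supseteq T_0\supseteq T_1\supseteq T_2\supseteq\cdots$. Define $\psi\colon T\to\mathrm{Homeo}(X)$ by $$\psi(t)=g_1\phi_1(t)g_2\phi_2(t)\cdots g_k\phi_k(t),$$ such that the following hold for each $i=1,2,\ldots,k$: (i) $g_i\in\mathrm{Homeo}(X)$; (ii) $\phi_i\colon T\to\mathrm{Homeo}(X)$ is attracting to $C_i$; (iii) $C_i\cap g_{i+1}C_{i+1}=\varnothing$, where indices are taken modulo $k$ (thus including $C_k\cap g_1C_1=\varnothing$); (iv) $X\ne g_1C_1\cup C_k$. Then $\psi$ is doubly attracting to $(g_1C_1,C_k)$.
   Context: Let $X$ be a topological space and $\phi\colon T\to\mathrm{Homeo}(X)$ a map (no continuity or homomorphism property is assumed). $\phi$ is attracting to $C$, where $C\subseteq X$ is a nonempty proper compact subset, if for each open neighborhood $U\supseteq C$ there exists $M>0$ such that $\phi(t)^{\pm1}(X\setminus U)\subseteq U$ for all $t\in T_M$. $\phi$ is doubly attracting to $(C^+,C^-)$, where $C^+,C^-$ are disjoint nonempty compact subsets of $X$ with $X\neq C^+\cup C^-$, if for each disjoint pair of open neighborhoods $(U^+,U^-)$ of $(C^+,C^-)$ there exists $M>0$ such that for all $t\in T_M$: $\phi(t)(X\setminus U^-)\subseteq U^+$ and $\phi(t)^{-1}(X\setminus U^+)\subseteq U^-$. *)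

(* Defs.v *)
From HB Require Import structures.
From mathcomp Require Import all_boot.
From mathcomp Require Import all_classical.
From mathcomp Require Import topology.

Set Implicit Arguments.
Unset Strict Implicit.
Unset Printing Implicit Defensive.

Local Open Scope classical_set_scope.

Record homeo (X : topologicalType) := Homeo {
  homeo_fun :> X -> X;
  homeo_inv : X -> X;
  homeo_funK : cancel homeo_fun homeo_inv;
  homeo_invK : cancel homeo_inv homeo_fun;
  homeo_fun_continuous : continuous homeo_fun;
  homeo_inv_continuous : continuous homeo_inv }.

Section HomeoGroup.
Variable X : topologicalType.

Lemma homeo_eq (f g : homeo X) : f =1 g -> f = g.
Proof.
case: f g => [f f' fK f'K cf cf'] [g g' gK g'K cg cg'] /= /funext fg; subst g.
have e : f' = g' by apply/funext => x; rewrite -{1}(g'K x) fK.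
by subst g'; congr Homeo; exact: Prop_irrelevance.
Qed.

Definition homeo1 : homeo X :=
  @Homeo X id id (fun=> erefl) (fun=> erefl) (fun=> cvg_id) (fun=> cvg_id).

Definition homeoV (f : homeo X) : homeo X :=
  Homeo (homeo_invK f) (homeo_funK f) (@homeo_inv_continuous X f)
    (@homeo_fun_continuous X f).

Definition homeoM (f g : homeo X) : homeo X :=
  @Homeo X (f \o g) (homeo_inv g \o homeo_inv f)
    (can_comp (homeo_funK f) (homeo_funK g))
    (can_comp (homeo_invK g) (homeo_invK f))
    (fun x => continuous_comp (@homeo_fun_continuous X g x)
                              (@homeo_fun_continuous X f (g x)))
    (fun x => continuous_comp (@homeo_inv_continuous X f x)
                              (@homeo_inv_continuous X g (homeo_inv f x))).

Lemma homeoMA : associative homeoM.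
Proof. by move=> f g h; exact: homeo_eq. Qed.

Lemma homeo1M : left_id homeo1 homeoM.
Proof. by move=> f; exact: homeo_eq. Qed.

Lemma homeoM1 : right_id homeo1 homeoM.
Proof. by move=> f; exact: homeo_eq. Qed.

Lemma homeoVM : left_inverse homeo1 homeoV homeoM.
Proof. by move=> f; apply: homeo_eq => x; exact: homeo_funK. Qed.

Lemma homeoMV : right_inverse homeo1 homeoV homeoM.
Proof. by move=> f; apply: homeo_eq => x; exact: homeo_invK. Qed.

HB.instance Definition _ := gen_eqMixin (homeo X).
HB.instance Definition _ := gen_choiceMixin (homeo X).
(* The product of Homeo(X) is composition: (f * g)%g x = f (g x). *)
HB.instance Definition _ := isGroup.Build (homeo X)
  homeoMA homeo1M homeoM1 homeoVM homeoMV.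

Lemma homeoME (f g : homeo X) x : (f * g)%g x = f (g x).
Proof. by []. Qed.

Lemma homeoVE (f : homeo X) x : (f^-1)%g x = homeo_inv f x.
Proof. by []. Qed.

End HomeoGroup.

(* [F M] stands for the subset $T_M$ of [T]. *)
Definition attracting (X : topologicalType) (T : Type) (F : nat -> set T)
    (phi : T -> homeo X) (C : set X) : Prop :=
  [/\ C !=set0, C <> setT, compact C &
    forall U : set X, open U -> C `<=` U ->
      exists2 M : nat, 0 < M & forall t, F M t ->
        phi t @` (~` U) `<=` U /\ (phi t)^-1%g @` (~` U) `<=` U].

Definition doubly_attracting (X : topologicalType) (T : Type)
    (F : nat -> set T) (phi : T -> homeo X) (Cp Cm : set X) : Prop :=
  [/\ Cp !=set0 /\ Cm !=set0, compact Cp /\ compact Cm,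
    Cp `&` Cm = set0, Cp `|` Cm <> setT &
    forall Up Um : set X, open Up -> open Um -> Cp `<=` Up -> Cm `<=` Um ->
      Up `&` Um = set0 ->
      exists2 M : nat, 0 < M & forall t, F M t ->
        phi t @` (~` Um) `<=` Up /\ (phi t)^-1%g @` (~` Up) `<=` Um].

(* Main.v *)
Require Import Defs.
From mathcomp Require Import all_boot.
From mathcomp Require Import all_classical.
From mathcomp Require Import topology.

Local Open Scope classical_set_scope.

(** The proof is a game of ping-pong.  Consecutive compact sets [C i] and
[g (i + 1) @` C (i + 1)] are disjoint, hence have disjoint open neighborhoods
[P i] and [Q i] because [X] is Hausdorff ([compact_separation]).  For
[i = k], where the cyclic successor is [0], the given pair [(Um, Up)] already
separates, and it is the one chosen.  So the open set
[W i], the intersection of [P i] with the preimage of [Q (i - 1)] under [g i],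
contains [C i], and for [t] far enough in [T] each [phi i t] sends the
complement of [W i] into [W i].  Then [g i * phi i t] sends the complement of
[P i] into [Q (i - 1)], which lies in the complement of [P (i - 1)]: the image
is ready for the next factor.  Composing all the factors
([prod_homeo_image_sub]) sends the complement of [P k = Um] into
[Q k = Up].

Only finitely many thresholds are involved, and since the sets [F n] decrease a
common one exists ([finite_threshold]).  The condition on the inverse map is
equivalent to the condition on the map, by taking complements
([homeoV_image_subC]). *)

(** * Separation of compact sets *)

(** A compact set that misses the set of cluster points of a filter already
misses the closure of one member: otherwise the traces on [K] of those closures
generate a proper filter, and its cluster point in [K] is a cluster point of
[G]. *)
Lemma compact_disjoint_cluster {X : topologicalType} {K : set X}
    {G : set_system X} :
  compact K -> Filter G -> K `&` cluster G = set0 ->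
  exists2 U, G U & K `&` closure U = set0.
Proof.
move=> cK FG KG0; apply: contrapT => noU.
have meet U : G U -> K `&` closure U !=set0.
  by move=> GU; apply/set0P/eqP => KU0; apply: noU; exists U.
pose H := filter_from G (fun U => K `&` closure U).
have FH : ProperFilter H.
  apply: filter_from_proper => [|U GU]; last exact: meet.
  apply: filter_from_filter; first by exists setT; exact: filterT.
  move=> U V GU GV; exists (U `&` V); first exact: filterI.
  by move=> x [Kx /closureI[cUx cVx]].
have HK : H K by exists setT; [exact: filterT | move=> x []].
have [p [Kp clHp]] := cK _ FH HK.
suff : (K `&` cluster G) p by rewrite KG0.
split=> //; rewrite clusterE => U GU.
apply: closed_closure => B nB.
have HU : H (closure U) by exists U => // x [].
exact: clHp.
Qed.

(** Compactness is used twice: for [B] against the neighborhoods of a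
point, then for [A] against the neighborhoods of [B]. *)
Lemma compact_separation {X : topologicalType} {A B : set X} :
  hausdorff_space X -> compact A -> compact B -> A `&` B = set0 ->
  exists P Q : set X,
    [/\ open P, open Q, A `<=` P, B `<=` Q & P `&` Q = set0].
Proof.
move=> hX cA cB AB0.
have far x : A x -> ~ cluster (set_nbhs B) x.
  move=> Ax clx.
  have Bx0 : B `&` cluster (nbhs x) = set0.
    rewrite -subset0 => y [By /hX xy].
    by rewrite -AB0; split=> //; rewrite -xy.
  have [U nU BU0] := compact_disjoint_cluster cB _ Bx0.
  have nBU : set_nbhs B (~` closure U).
    apply/set_nbhsP; exists (~` closure U); split=> //.
      exact/closed_openC/closed_closure.
    by apply/disjoints_subset.
  by have [y [ncUy /subset_closure]] := clx _ _ nBU nU.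
have Acl0 : A `&` cluster (set_nbhs B) = set0.
  by rewrite -subset0 => x [/far].
have [V nV AV0] := compact_disjoint_cluster cA _ Acl0.
have [Q [oQ BQ QV]] := iffLR (set_nbhsP _ _) nV.
exists (~` closure V), Q; split=> //.
- exact/closed_openC/closed_closure.
- by apply/disjoints_subset.
- by rewrite -subset0 => x [ncVx /QV/subset_closure].
Qed.

(** * Homeomorphisms and their products *)

Lemma homeo_image_compact {X : topologicalType} (f : homeo X) {K : set X} :
  compact K -> compact (f @` K).
Proof.
by apply: continuous_compact; apply: continuous_subspaceT;
  exact: homeo_fun_continuous.
Qed.

Lemma homeoV_image_subC {X : topologicalType} {f : homeo X} {U V : set X} :
  f @` (~` U) `<=` V -> (f^-1)%g @` (~` V) `<=` U.
Proof.
move=> fUV _ [x nVx <-]; rewrite homeoVE; apply: contrapT => nU.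
by apply: nVx; rewrite -(homeo_invK f x); apply: fUV; exists (homeo_inv f x).
Qed.

(** The product is composition, so its last factor acts first: this is why the
sets are traversed from [A n] down to [A 0]. *)
Lemma prod_homeo_image_sub {X : topologicalType} {n : nat}
    (f : 'I_n -> homeo X) (A : nat -> set X) :
  (forall i : 'I_n, f i @` A i.+1 `<=` A i) ->
  (\prod_(i < n) f i)%g @` A n `<=` A 0.
Proof.
elim: n f A => [|n IHn] f A fA; first by rewrite big_ord0 => _ [x Ax <-].
rewrite big_ord_recl => _ [x Ax <-]; rewrite homeoME.
apply: (fA ord0); eexists; last by [].
apply: (IHn (fun i => f (lift ord0 i)) (fun i => A i.+1)); last by exists x.
by move=> i; exact: (fA (lift ord0 i)).
Qed.

(** * Attracting families *)

Lemma finite_threshold {I : finType} {T : Type} {F : nat -> set T}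
    {R : I -> T -> Prop} :
  (forall n, F n.+1 `<=` F n) ->
  (forall i, exists M : nat, forall t, F M t -> R i t) ->
  exists2 M : nat, 0 < M & forall t, F M t -> forall i, R i t.
Proof.
move=> hF /choice[m mR].
have decF a b : a <= b -> F b `<=` F a.
  by move=> /subnK <-; elim: (b - a) => [//|d IHd] t; rewrite addSn => /hF/IHd.
exists (\max_i m i).+1 => // t FMt i.
by apply/mR/(decF _ _ _ _ FMt)/leqW/leq_bigmax.
Qed.

(** One round of the game: attraction is applied to the neighborhood
[P `&` g @^-1` Q] of [C], whose complement contains [~` P] and whose image
under [g] lies in [Q]. *)
Lemma attracting_image_sub {X : topologicalType} {T : Type} {F : nat -> set T}
    {phi : T -> homeo X} {C : set X} {g : homeo X} {P Q : set X} :
  attracting F phi C -> open P -> open Q -> C `<=` P -> g @` C `<=` Q ->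
  exists M : nat, forall t, F M t -> (g * phi t)%g @` (~` P) `<=` Q.
Proof.
move=> [_ _ _ attr] oP oQ CP gCQ.
have oW : open (P `&` g @^-1` Q).
  apply: openI => //; apply: open_comp => // x _.
  exact: homeo_fun_continuous.
have CW : C `<=` P `&` g @^-1` Q.
  by move=> x Cx; split; [exact: CP | apply: gCQ; exists x].
have [M _ HM] := attr _ oW CW; exists M => t /HM[Hphi _] _ [x nPx <-].
rewrite homeoME.
by have [] : (P `&` g @^-1` Q) (phi t x) by apply: Hphi; exists x => // -[].
Qed.

Theorem lemma3p6 (X : topologicalType) (hX : hausdorff_space X) (k : nat)
    (T : Type) (F : nat -> set T) (hF : forall n, F n.+1 `<=` F n)
    (g : 'I_k.+1 -> homeo X) (phi : 'I_k.+1 -> T -> homeo X)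
    (C : 'I_k.+1 -> set X)
    (hphi : forall i, attracting F (phi i) (C i))
    (hdisj : forall i, C i `&` g (ordS i) @` C (ordS i) = set0)
    (hunion : setT <> g ord0 @` C ord0 `|` C ord_max) :
  doubly_attracting F (fun t => \prod_(i < k.+1) (g i * phi i t))%g
    (g ord0 @` C ord0) (C ord_max).
Proof.
have C0 i : C i !=set0 by case: (hphi i).
have cC i : compact (C i) by case: (hphi i).
have cgC i : compact (g i @` C i) by exact: homeo_image_compact.
have ordS_max : ordS ord_max = ord0 :> 'I_k.+1.
  by apply: val_inj; rewrite /= modnn.
split=> //.
- by split=> //; have [x Cx] := C0 ord0; exists (g ord0 x), x.
- by rewrite setIC -ordS_max hdisj.
- by move/esym.
move=> Up Um oUp oUm CUp CUm UpUm0.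
have sep i : exists PQ : set X * set X,
    [/\ open PQ.1 /\ open PQ.2, C i `<=` PQ.1,
        g (ordS i) @` C (ordS i) `<=` PQ.2, PQ.1 `&` PQ.2 = set0 &
        i = ord_max -> PQ = (Um, Up)].
  have [->|ni] := eqVneq i ord_max.
    by exists (Um, Up); split; rewrite ?ordS_max //= setIC.
  have [P [Q [oP oQ CP gCQ PQ0]]] :=
    compact_separation hX (cC i) (cgC (ordS i)) (hdisj i).
  by exists (P, Q); split=> // /eqP; rewrite (negPf ni).
have [PQ PQP] := choice sep.
have [PQmax] : PQ ord_max = (Um, Up) by case: (PQP ord_max) => _ _ _ _; exact.
have attr i : exists M : nat, forall t, F M t ->
    (g i * phi i t)%g @` (~` (PQ i).1) `<=` (PQ (ord_pred i)).2.
  have [[oP _] CP _ _ _] := PQP i.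
  have [[_ oQ] _ gCQ _ _] := PQP (ord_pred i).
  by apply: (attracting_image_sub (hphi i)) => //; rewrite ord_predK in gCQ.
have [M M0 HM] := finite_threshold hF attr; exists M => // t /HM step.
suff fwd : (\prod_(i < k.+1) (g i * phi i t))%g @` (~` Um) `<=` Up.
  by split=> //; exact: homeoV_image_subC fwd.
(* [A i.+1] is what the factor of index [i] acts on, and [A 0] is the final
   target. *)
pose A j := if j is i.+1 then ~` (PQ (inord i)).1 else Up.
have -> : ~` Um = A k.+1.
  have e : inord k = ord_max :> 'I_k.+1 by apply: val_inj; rewrite /= inordK.
  by rewrite /A e PQmax.
apply: prod_homeo_image_sub => i; rewrite {1}/A inord_val.
apply: subset_trans (step i) _.
case: i => -[|j] lt_jk.
  have -> : ord_pred (Ordinal lt_jk) = ord_max.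
    by rewrite -[RHS]ordSK ordS_max; congr ord_pred; apply: val_inj.
  by rewrite PQmax.
have -> : ord_pred (Ordinal lt_jk) = inord j.
  rewrite -[RHS]ordSK; congr ord_pred; apply: val_inj.
  by rewrite /= inordK ?modn_small // ltnW.
by have [_ _ _ PQ0 _] := PQP (inord j); apply/disjoints_subset; rewrite setIC.
Qed.
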